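(* Let $\Delta t>0$ and consider the fourth-order time discretizations $\textbf{Scheme-2F}(\Delta t)$ and $\textbf{Scheme-4F}(\Delta t)$ of the Vlasov–Ampère system defined in the context, under periodic boundary conditions in $\mathbf x$ and vanishing boundary conditions in $\mathbf v$. If $(f^{n+1},\mathbf E^{n+1})$ is obtained from $(f^n,\mathbf E^n)$ by one step of either scheme, then $TE_n=TE_{n+1}$, where $$2\,TE_n=\int_{\Omega_x}\int_{\Omega_v} f^n|\mathbf v|^2\,d\mathbf v\,d\mathbf x+\int_{\Omega_x}|\mathbf E^n|^2\,d\mathbf x.$$
   Context: The Vlasov–Ampère system is $\partial_t f+\mathbf v\cdot\nabla_{\mathbf x}f+\mathbf E\cdot\nabla_{\mathbf v}f=0$, $\partial_t\mathbf E=-\mathbf J$, with $\mathbf J(\mathbf x,t)=\int_{\Omega_v}f\,\mathbf v\,d\mathbf v$, on $\Omega_x\times\Omega_v$ (both of the same dimension). Only time is discretized; $f=f(\mathbf x,\mathbf v)$ (scalar) and $\mathbf E=\mathbf E(\mathbf x)$ (vector valued) are functions of continuous variables. The following maps send $(f^{\rm old},\mathbf E^{\rm old})$ to $(f^{\rm new},\mathbf E^{\rm new})$, with $\mathbf J^{\rm old/new}=\int_{\Omega_v}f^{\rm old/new}\mathbf v\,d\mathbf v$ and real step $\tau\neq0$ (possibly negative): $\textbf{Scheme-2}(\tau)$: $$\frac{f^{\rm new}-f^{\rm old}}{\tau}+\mathbf v\cdot\nabla_{\mathbf x}\frac{f^{\rm old}+f^{\rm new}}2+\tfrac12(\mathbf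 E^{\rm old}+\mathbf E^{\rm new})\cdot\nabla_{\mathbf v}\frac{f^{\rm old}+f^{\rm new}}2=0,\qquad \frac{\mathbf E^{\rm new}-\mathbf E^{\rm old}}{\tau}=-\tfrac12(\mathbf J^{\rm old}+\mathbf J^{\rm new}).$$ $\textbf{Scheme-a}(\tau)$: $$\frac{f^{\rm new}-f^{\rm old}}{\tau}+\mathbf v\cdot\nabla_{\mathbf x}\frac{f^{\rm old}+f^{\rm new}}2=0,\qquad \mathbf E^{\rm new}=\mathbf E^{\rm old}.$$ $\textbf{Scheme-b}(\tau)$: $$\frac{f^{\rm new}-f^{\rm old}}{\tau}+\tfrac12(\mathbf E^{\rm old}+\mathbf E^{\rm new})\cdot\nabla_{\mathbf v}\frac{f^{\rm old}+f^{\rm new}}2=0,\qquad \frac{\mathbf E^{\rm new}-\mathbf E^{\rm old}}{\tau}=-\tfrac12(\mathbf J^{\rm old}+\mathbf J^{\rm new}).$$ $\textbf{Scheme-4}(\tau)=\textbf{Scheme-a}(\tau/2)\,\textbf{Scheme-b}(\tau)\,\textbf{Scheme-a}(\tau/2)$ (composition). Let $\beta_1=\beta_3=(2+2^{1/3}+2^{-1/3})/3$ and $\beta_2=1-2\beta_1<0$, so that $\beta_1+\beta_2+\beta_3=1$ and $\beta_1^3+\beta_2^3+\beta_3^3=1$. For $X\in\{2,4\}$, $$\textbf{Scheme-}X\textbf{F}(\Delta t)=\textbf{Scheme-}X(\beta_1\Delta t)\,\textbf{Scheme-}X(\beta_2\Delta t)\,\textbf{Scheme-}X(\beta_3\Delta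 t).$$ Since the schemes are implicit, the statement concerns any functions satisfying these equations. Boundary conditions: $\Omega_x$ is a finite (periodic) box and all functions are periodic in $\mathbf x$; either $\Omega_v$ is a bounded domain and all approximations of $f$ (including intermediate ones) vanish on $\partial\Omega_v$, or $\Omega_v$ is the whole space and they tend to $0$ as $|\mathbf v|\to\infty$. All functions are smooth enough, and decay fast enough in $\mathbf v$, for the integrals to be finite and for integration by parts to be valid without boundary terms. *)

(* Defs.v *)
From HB Require Import structures.
From mathcomp Require Import all_boot all_order all_algebra.
From mathcomp Require Import all_classical all_reals all_analysis.

Set Implicit Arguments.
Unset Strict Implicit.
Unset Printing Implicit Defensive.

Import Order.TTheory GRing.Theory Num.Theory.
Import numFieldNormedType.Exports.

Local Open Scope classical_set_scope.
Local Open Scope ring_scope.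

(* The library has the product sigma-algebra on n-tuples but no n-fold product
   measure: it is built here as mu (x) (mu (x) ...) transported along
   (t, u) |-> t :: u. *)
Section tuple_measure.
Context d (T : measurableType d) (R : realType).

Definition tcons n (p : (T * n.-tuple T)%type) : n.+1.-tuple T :=
  [tuple of p.1 :: p.2].

Definition tuncons n (t : n.+1.-tuple T) : (T * n.-tuple T)%type :=
  (thead t, [tuple of behead t]).

Lemma tconsK n : cancel (@tcons n) (@tuncons n).
Proof. by case=> t u; congr pair; apply/val_inj. Qed.

Lemma measurable_tcons n : measurable_fun setT (@tcons n).
Proof. exact: (@measurable_cons _ _ _ _ fst n snd). Qed.

Lemma measurable_tuncons n : measurable_fun setT (@tuncons n).
Proof.
apply: measurable_fun_pair; last exact: measurable_behead.
exact: (measurable_tnth ord0).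
Qed.

Section push.
Variables (m1 : {sigma_finite_measure set T -> \bar R}) (n : nat).
Variable m2 : {sigma_finite_measure set (n.-tuple T) -> \bar R}.

Definition tcons_measure : set (n.+1.-tuple T) -> \bar R :=
  pushforward (m1 \x m2)%E (@tcons n).

Let tcons_measure0 : tcons_measure set0 = 0%E.
Proof. by rewrite /tcons_measure /pushforward preimage_set0 measure0. Qed.

Let tcons_measure_ge0 A : (0 <= tcons_measure A)%E.
Proof. by rewrite /tcons_measure /pushforward measure_ge0. Qed.

Let tcons_measure_sigma_additive : semi_sigma_additive tcons_measure.
Proof.
apply: (@measure_semi_sigma_additive _ _ _
  (pushforward (m1 \x m2)%E (@tcons n))).
exact: measurable_tcons.
Qed.

HB.instance Definition _ := isMeasure.Build _ _ _ tcons_measure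
  tcons_measure0 tcons_measure_ge0 tcons_measure_sigma_additive.

Let tcons_measure_sigma_finite : sigma_finite setT tcons_measure.
Proof.
have /sigma_finiteP[F [TF ndF Foo]] := sigma_finiteT m1.
have /sigma_finiteP[G [TG ndG Goo]] := sigma_finiteT m2.
exists (fun k => @tuncons n @^-1` (F k `*` G k)).
  rewrite -preimage_bigcup (_ : \bigcup_k _ = setT) ?preimage_setT//.
  rewrite -setXTT TF TG predeqE => -[x y]; split.
    by move=> [k _ [Fx Gy]]; split; exists k.
  move=> [/= [k _ Fkx] [l _ Gly]]; exists (maxn k l) => //; split.
  - by move: x Fkx; exact/subsetPset/ndF/leq_maxl.
  - by move: y Gly; exact/subsetPset/ndG/leq_maxr.
move=> k; have [mF Fk] := Foo k; have [mG Gk] := Goo k.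
split.
  rewrite -[X in measurable X]setTI; apply: measurable_tuncons => //.
  exact: measurableX.
rewrite /tcons_measure /pushforward -comp_preimage.
rewrite (_ : @tuncons n \o @tcons n = id); last exact/funext/tconsK.
by rewrite preimage_id product_measure1E// lte_mul_pinfty// ge0_fin_numE.
Qed.

HB.instance Definition _ := @Measure_isSigmaFinite.Build _ _ _ tcons_measure
  tcons_measure_sigma_finite.

End push.

Fixpoint tuple_measure (mu : {sigma_finite_measure set T -> \bar R}) n :
    {sigma_finite_measure set (n.-tuple T) -> \bar R} :=
  match n with
  | 0 => \d_ ([tuple] : 0.-tuple T)
  | k.+1 => tcons_measure mu (tuple_measure mu k)
  end.

End tuple_measure.

Section lebesgue_tuple.
Variable R : realType.

Definition lebesgue_tuple n :
    {sigma_finite_measure set (n.-tuple (measurableTypeR R)) -> \bar R} :=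
  tuple_measure (@lebesgue_measure R) n.

End lebesgue_tuple.

Section phase_space.
Context {R : realType} {d : nat}.
Implicit Types (u w x v : 'rV[R]_d) (W : set 'rV[R]_d).

(* Euclidean product; the library norm on row vectors is the sup norm *)
Definition dotv u w : R := \sum_i u 0 i * w 0 i.

Definition basis_vec (i : 'I_d) : 'rV[R]_d := delta_mx 0 i.

Definition grad (g : 'rV[R]_d -> R) x : 'rV[R]_d :=
  \row_i 'D_(basis_vec i) g x.

Definition row_of_tuple (t : d.-tuple (measurableTypeR R)) : 'rV[R]_d :=
  \row_i tnth t i.

Definition int_over W (g : 'rV[R]_d -> R) : R :=
  \int[lebesgue_tuple R d]_(t in row_of_tuple @^-1` W) g (row_of_tuple t).

Definition integrable_over W (g : 'rV[R]_d -> R) : Prop :=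
  (lebesgue_tuple R d).-integrable (row_of_tuple @^-1` W)
    (fun t => (g (row_of_tuple t))%:E).

Definition integrable_over2 W1 W2 (g : 'rV[R]_d -> 'rV[R]_d -> R) : Prop :=
  (lebesgue_tuple R d \x lebesgue_tuple R d)%E.-integrable
    ((row_of_tuple @^-1` W1) `*` (row_of_tuple @^-1` W2))
    (fun p => (g (row_of_tuple p.1) (row_of_tuple p.2))%:E).

Definition boundary W : set 'rV[R]_d := closure W `\` W°.

Definition bounded_domain W : Prop :=
  [/\ open W, connected W, W !=set0 & bounded_set W].

Definition velocity_domain W : Prop := bounded_domain W \/ W = setT.

Definition box (a b : 'rV[R]_d) : set 'rV[R]_d :=
  [set x | forall i, a 0 i <= x 0 i <= b 0 i].

Definition periodic {T : Type} (a b : 'rV[R]_d) (g : 'rV[R]_d -> T) : Prop :=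
  forall x i, g (x + (b 0 i - a 0 i) *: basis_vec i) = g x.

Definition vanishes_at_infinity (g : 'rV[R]_d -> R) : Prop :=
  forall e : R, 0 < e ->
    exists M : R, forall v, M < `|v| -> `|g v| < e.

End phase_space.

Section vlasov_ampere.
Context {R : realType} {d : nat}.

Definition distribution_fun := 'rV[R]_d -> 'rV[R]_d -> R.
Definition field_fun := 'rV[R]_d -> 'rV[R]_d.
Definition state := (distribution_fun * field_fun)%type.

Implicit Types (f : distribution_fun) (E : field_fun) (s : state).

Definition grad_x f : 'rV[R]_d -> 'rV[R]_d -> 'rV[R]_d :=
  fun x v => grad (f^~ v) x.

Definition grad_v f : 'rV[R]_d -> 'rV[R]_d -> 'rV[R]_d :=
  fun x v => grad (f x) v.

Definition avg_f f0 f1 : distribution_fun :=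
  fun x v => (f0 x v + f1 x v) / 2.

Definition avg_E E0 E1 : field_fun := fun x => 2^-1 *: (E0 x + E1 x).

Section domain.
(* The position box is box a b; functions of x live on all of R^d and are
   periodic with periods b_i - a_i. A distribution f is only meaningful for v in
   the closure of Wv. *)
Variables (a b : 'rV[R]_d) (Wv : set 'rV[R]_d).

(* "smooth enough": C^1 on R^d x Wv and continuous up to the boundary *)
Definition smooth_f f : Prop :=
  {within [set p | closure Wv p.2], continuous (fun p => f p.1 p.2)} /\
  forall x v, Wv v -> forall i,
    [/\ derivable (f^~ v) x (basis_vec i),
        derivable (f x) v (basis_vec i),
        {for (x, v), continuous (fun p => grad_x f p.1 p.2 0 i)} &
        {for (x, v), continuous (fun p => grad_v f p.1 p.2 0 i)}].

(* "fast enough decay in v": the current density and the integrals met when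
   taking the second velocity moment of the Vlasov equation are finite *)
Definition decay_f f : Prop :=
  [/\ forall x i, integrable_over Wv (fun v => f x v * v 0 i),
      forall i, integrable_over2 (box a b) Wv (fun x v => f x v * v 0 i),
      integrable_over2 (box a b) Wv (fun x v => f x v * dotv v v),
      forall i, integrable_over2 (box a b) Wv
        (fun x v => v 0 i * grad_x f x v 0 i * dotv v v) &
      forall i, integrable_over2 (box a b) Wv
        (fun x v => grad_v f x v 0 i * dotv v v)].

Definition vanishing_f f : Prop :=
  (forall x v, boundary Wv v -> f x v = 0) /\
  (Wv = setT -> forall x, vanishes_at_infinity (f x)).

Definition admissible s : Prop :=
  [/\ forall v, closure Wv v -> periodic a b (s.1^~ v),
      vanishing_f s.1, smooth_f s.1, decay_f s.1 &
      periodic a b s.2 /\ continuous s.2].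

Definition current f : field_fun :=
  fun x => \row_i int_over Wv (fun v => f x v * v 0 i).

Definition ampere (tau : R) s0 s1 : Prop :=
  forall x, tau^-1 *: (s1.2 x - s0.2 x) =
            - (2^-1 *: (current s0.1 x + current s1.1 x)).

Definition scheme_2 (tau : R) s0 s1 : Prop :=
  (forall x v, Wv v ->
     (s1.1 x v - s0.1 x v) / tau
     + dotv v (grad_x (avg_f s0.1 s1.1) x v)
     + dotv (avg_E s0.2 s1.2 x) (grad_v (avg_f s0.1 s1.1) x v) = 0) /\
  ampere tau s0 s1.

Definition scheme_a (tau : R) s0 s1 : Prop :=
  (forall x v, Wv v ->
     (s1.1 x v - s0.1 x v) / tau
     + dotv v (grad_x (avg_f s0.1 s1.1) x v) = 0) /\
  (forall x, s1.2 x = s0.2 x).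

Definition scheme_b (tau : R) s0 s1 : Prop :=
  (forall x v, Wv v ->
     (s1.1 x v - s0.1 x v) / tau
     + dotv (avg_E s0.2 s1.2 x) (grad_v (avg_f s0.1 s1.1) x v) = 0) /\
  ampere tau s0 s1.

(* The schemes are implicit, hence relations (from old to new state). In
   step_comp P Q, as for operators, Q acts first; the intermediate state is subject
   to the same boundary and regularity conditions as the others. *)
Definition step_comp (P Q : state -> state -> Prop) s0 s1 : Prop :=
  exists s, [/\ admissible s, Q s0 s & P s s1].

Definition scheme_4 (tau : R) : state -> state -> Prop :=
  step_comp (scheme_a (tau / 2)) (step_comp (scheme_b tau) (scheme_a (tau / 2))).

Definition beta1 : R := (2 + 2 `^ (3^-1) + 2 `^ (- 3^-1)) / 3.
Definition beta2 : R := 1 - 2 * beta1.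
Definition beta3 : R := beta1.

Definition fourth_order (S : R -> state -> state -> Prop) (dt : R) :
    state -> state -> Prop :=
  step_comp (S (beta1 * dt)) (step_comp (S (beta2 * dt)) (S (beta3 * dt))).

Definition scheme_2F := fourth_order scheme_2.
Definition scheme_4F := fourth_order scheme_4.

Definition total_energy s : R :=
  2^-1 * (int_over (box a b)
            (fun x => int_over Wv (fun v => s.1 x v * dotv v v))
          + int_over (box a b) (fun x => dotv (s.2 x) (s.2 x))).

End domain.
End vlasov_ampere.

(* Main.v *)
(* On a step with time increment [tau], multiply the (transport and/or force)
   equation by [|v|^2] and integrate over the box times [Wv]. The transport term
   vanishes by periodicity in [x]; integrating the force term by parts in [v]
   gives [tau * int (E0 + E1)/2 . (J0 + J1)], which by the Ampere equation is
   [- (int |E1|^2 - int |E0|^2)]. So each elementary scheme conserves the energy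
   for any [tau <> 0], and the composed schemes only use the increments
   [beta1 * dt], [beta2 * dt] and their halves, all nonzero as [beta1 >= 2/3].
   Integration by parts on an arbitrary open [Wv] is done on lines parallel to
   an axis: almost every slice is an open subset of the real line on which the
   derivative is integrable, and the primitive vanishes at the endpoints of the
   components of the slice. *)
Require Import Defs.
From mathcomp Require Import all_boot all_order all_algebra.
From mathcomp Require Import all_classical all_reals all_analysis.
From mathcomp Require Import measurable_realfun ring lra.

Set Implicit Arguments.
Unset Strict Implicit.
Unset Printing Implicit Defensive.

Import Order.TTheory GRing.Theory Num.Theory.
Import numFieldNormedType.Exports.

Local Open Scope classical_set_scope.
Local Open Scope ring_scope.

(** * Integration of derivatives on open subsets of the real line *)

(** Dominated convergence for the restrictions of [f] to the sets [A_ n]: each is bounded by the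
    absolute value of [f], and at a given point their values are eventually constant. *)
Lemma cvg_integral_setwise d (T : measurableType d) (R : realType)
    (mu : {measure set T -> \bar R}) (A_ : (set T)^nat) (A : set T)
    (f : T -> R) :
  (forall n, measurable (A_ n)) -> measurable A ->
  mu.-integrable setT (EFin \o f) ->
  (forall t, \forall n \near \oo, A_ n t <-> A t) ->
  (\int[mu]_(t in A_ n) (f t)%:E @[n --> \oo] --> \int[mu]_(t in A) (f t)%:E)%E.
Proof.
move=> mA_ mA intf A_A.
have mf : measurable_fun setT (EFin \o f) by case/integrableP : intf.
rewrite integral_mkcond; under eq_fun do rewrite integral_mkcond.
apply: (@dominated_cvg _ _ _ _ _ measurableT _ _ (abse \o (EFin \o f))) => //.
- move=> n; apply/(measurable_restrictT _ _).1 => //.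
  exact: measurable_funTS.
- by move=> t _; apply: cvg_near_cst; apply: filterS (A_A t) => n [At tA];
    rewrite !patchE; case: ifPn => tAn; case: ifPn => tA' //; exfalso;
    [move: tA' tAn; rewrite notin_setE inE; tauto
    |move: tA' tAn; rewrite notin_setE inE; tauto].
- exact: integrable_abse.
- by move=> n t _; rewrite patchE; case: ifPn => //= _; rewrite normr0 lee_fin.
Qed.

Section antiderivative.
Context {R : realType}.
Notation mu := (@lebesgue_measure R).
Variables (U : set R) (G H : R -> R).
Hypothesis dG : forall s, U s -> is_derive s 1 G (H s).
Hypothesis cH : forall s, U s -> {for s, continuous H}.

Lemma integral_segment_derive a b : a < b -> `[a, b] `<=` U ->
  (\int[mu]_(s in `[a, b]) (H s)%:E = (G b)%:E - (G a)%:E)%E.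
Proof.
move=> ab abU; apply: continuous_FTC2 => //.
- by apply: continuous_in_subspaceT => s; rewrite inE => /abU/cH.
- have cG s : U s -> {for s, continuous G}.
    move=> /dG[dGs _]; apply: differentiable_continuous.
    by apply/derivable1_diffP; exact: dGs.
  have [aU bU] : U a /\ U b.
    by split; apply: abU; rewrite /= in_itv/= lexx ltW.
  split.
  + by move=> s /subset_itv_oo_cc/abU/dG[].
  + exact: cvg_at_right_filter (cG _ aU).
  + exact: cvg_at_left_filter (cG _ bU).
- by move=> s /subset_itv_oo_cc/abU/dG[_ <-]; rewrite derive1E.
Qed.

(** The integral over [[a_ n, b_ n]] is [G (b_ n) - G (a_ n)], which tends to 0; it also tends to
    the integral over [J]. Asking only that each point of [J] lie eventually in the segments leaves
    freedom in the choice of the endpoints. *)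
Lemma integral_derive_exhaust (a_ b_ : R^nat) (J : set (measurableTypeR R)) :
  measurable J ->
  J `<=` U -> mu.-integrable J (EFin \o H) ->
  (forall n, a_ n < b_ n) -> (forall n, `[a_ n, b_ n] `<=` J) ->
  (forall s, J s -> \forall n \near \oo, a_ n <= s <= b_ n) ->
  G (b_ n) - G (a_ n) @[n --> \oo] --> 0 ->
  (\int[mu]_(s in J) (H s)%:E = 0)%E.
Proof.
move=> mJ JU intH ab abJ Jab Gab.
(* [H] is extended by 0 outside [J], to have a single function integrable on the whole line. *)
have intHJ : mu.-integrable setT (EFin \o (H \_ J)).
  rewrite -restrict_EFin.
  exact: (@integrable_mkcond _ _ _ mu J (EFin \o H) mJ).1.
have : (\int[mu]_(s in `[a_ n, b_ n]) ((H \_ J) s)%:E @[n --> \oo] -->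
        \int[mu]_(s in J) ((H \_ J) s)%:E)%E.
  apply: cvg_integral_setwise => // s.
  have [Js|nJs] := pselect (J s).
    by apply: filterS (Jab _ Js) => n abs; split => // _; rewrite /= in_itv.
  by apply: nearW => n; split => // /abJ.
have -> : (fun n => \int[mu]_(s in `[a_ n, b_ n]) ((H \_ J) s)%:E)%E =
          (fun n => (G (b_ n) - G (a_ n))%:E).
  apply/funext => n; rewrite EFinB -integral_segment_derive//.
    by apply: eq_integral => s; rewrite inE => /abJ Js; rewrite patchE mem_set.
  exact: subset_trans (abJ n) JU.
have -> : (\int[mu]_(s in J) ((H \_ J) s)%:E = \int[mu]_(s in J) (H s)%:E)%E.
  by apply: eq_integral => s Js; rewrite patchE Js.
move=> /cvg_unique; apply; first exact: ereal_hausdorff.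
exact/cvg_EFin/Gab/nearW.
Qed.

End antiderivative.

Section antiderivative_on_open.
Context {R : realType}.
Notation mu := (@lebesgue_measure R).
Variables (U : set R) (G H : R -> R).
Hypothesis oU : open U.
Hypothesis dG : forall s, U s -> is_derive s 1 G (H s).
Hypothesis cH : forall s, U s -> {for s, continuous H}.
Hypothesis intH : mu.-integrable U (EFin \o H).

Let cvg_boundary (u : R^nat) (s : R) :
  (G t @[t --> within U (nbhs s)] --> 0) -> (forall n, U (u n)) ->
  u n @[n --> \oo] --> s -> G (u n) @[n --> \oo] --> 0.
Proof.
move=> Gs Uu us; apply: cvg_comp Gs => P /us UP.
suff : \forall n \near \oo, P (u n) by [].
by apply: filterS (UP : \forall n \near \oo, U (u n) -> P (u n)) => n; apply.
Qed.

Let closure_limit (u : R^nat) (s : R) : (forall n, U (u n)) ->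
  u n @[n --> \oo] --> s -> closure U s.
Proof. by move=> Uu us B /us[N _ /(_ _ (leqnn N)) BuN]; exists (u N). Qed.

(** [U] is a countable disjoint union of bounded open intervals. The integral over each one vanishes
    because its endpoints lie in the closure of [U] but not in [U], so that [G] tends to 0 there;
    countable additivity concludes. *)
Lemma integral_derive_bounded :
  has_lbound U -> has_ubound U ->
  (forall s : R, closure U s -> ~ U s ->
     G t @[t --> within U (nbhs s)] --> 0) ->
  (\int[mu]_(s in U) (H s)%:E = 0)%E.
Proof.
move=> lbU ubU bG.
pose I := open_disjoint_itv oU.
have oI : forall k, open (I k) by exact: open_disjoint_itv_open.
have iI : forall k, is_interval (I k) by exact: open_disjoint_itv_is_interval.
have tI : trivIset setT I by exact: open_disjoint_itv_trivIset.
have UI : U = \bigcup_k I k by exact: open_disjoint_itv_bigcup.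
have IU k : I k `<=` U by rewrite UI; exact: bigcup_sup.
have mI k : measurable (I k : set (measurableTypeR R)).
  exact: open_measurable.
rewrite {1}UI integral_bigcup//; last by rewrite -UI.
apply: eseries0 => k _ _.
have [->|/set0P[s0 Is0]] := eqVneq (I k) set0; first by rewrite integral_set0.
pose a := inf (I k); pose b := sup (I k).
have lbI : has_lbound (I k) by apply: subset_has_lbound lbU.
have ubI : has_ubound (I k) by apply: subset_has_ubound ubU.
have IE : I k = [set x | a < x < b].
  rewrite -interval_bounded_interior//; apply/esym/interior_id; exact: oI.
have ab : a < b by move: Is0; rewrite IE => /= /andP[]; exact: lt_trans.
(* A denominator above 2 for every [n], including 0, ensures [a + e n < b - e n]. *)
pose e n := (b - a) / n.+3%:R.
have e_gt0 n : 0 < e n by rewrite divr_gt0// subr_gt0.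
have e_lt n : e n < (b - a) / 2.
  by rewrite ltr_pM2l ?subr_gt0// ltf_pV2 ?posrE// ltr_nat.
have e0 : e n @[n --> \oo] --> 0.
  rewrite -[0](mulr0 (b - a)); apply: cvgMl_tmp.
  have := @cvg_harmonic R; rewrite -(cvg_shiftn 2%N) /=.
  by under eq_fun do rewrite addn2.
have Ia n : I k (a + e n).
  rewrite IE /=; have := e_lt n; have := e_gt0 n; set x := e n; lra.
have Ib n : I k (b - e n).
  rewrite IE /=; have := e_lt n; have := e_gt0 n; set x := e n; lra.
have cvga : a + e n @[n --> \oo] --> a.
  by rewrite -[X in _ --> X]addr0; apply: cvgD => //; exact: cvg_cst.
have cvgb : b - e n @[n --> \oo] --> b.
  by rewrite -[X in _ --> X]subr0; apply: cvgB => //; exact: cvg_cst.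
(* If a limit of points of [I k] lay in another interval [I m], then [I m], being open, would meet
   [I k], against disjointness. *)
have notU (u : R^nat) s : (forall n, I k (u n)) -> u n @[n --> \oo] --> s ->
    ~ I k s -> ~ U s.
  move=> Iu us nIs; rewrite UI => -[m _ Ims].
  have /us[N _ /(_ _ (leqnn N)) ImuN] : nbhs s (I m) by exact: open_nbhs_nbhs.
  suff mk : m = k by apply: nIs; rewrite -mk.
  by apply: (tI m k) => //; exists (u N).
apply: (@integral_derive_exhaust _ U G H dG cH (fun n => a + e n)
  (fun n => b - e n)) => //.
- by apply: integrableS intH => //; exact: open_measurable.
- by move=> n; have := e_lt n; set x := e n; lra.
- move=> n s /=; rewrite in_itv/= IE /=; have := e_gt0 n; set x := e n; lra.
- move=> s; rewrite IE /= => /andP[as_ sb].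
  have m0 : 0 < Num.min (s - a) (b - s) by rewrite lt_min !subr_gt0 as_.
  move/cvgrPdist_lt: e0 => /(_ _ m0); apply: filterS => n.
  rewrite sub0r normrN gtr0_norm// lt_min => /andP[]; set x := e n.
  by move=> ? ?; apply/andP; split; lra.
- rewrite -[X in _ --> X](subrr 0); apply: cvgB.
  + apply: (@cvg_boundary _ b) => //; last by move=> n; exact/IU/Ib.
    apply: bG.
      by apply: closure_limit cvgb => n; exact/IU/Ib.
    by apply: (notU _ b Ib) => //; rewrite IE /= ltxx andbF.
  + apply: (@cvg_boundary _ a) => //; last by move=> n; exact/IU/Ia.
    apply: bG.
      by apply: closure_limit cvga => n; exact/IU/Ia.
    by apply: (notU _ a Ia) => //; rewrite IE /= ltxx.
Qed.

End antiderivative_on_open.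

(* [G] need not be known to vanish at infinity: being integrable, it is small at
   some point of each [[n, n + 1]] and of each [[- n - 2, - n - 1]]. *)
Lemma integral_derive_line {R : realType} (G H : R -> R) :
  (forall s : R, is_derive s 1 G (H s)) -> continuous H ->
  (@lebesgue_measure R).-integrable setT (EFin \o H) ->
  (@lebesgue_measure R).-integrable setT (EFin \o G) ->
  (\int[@lebesgue_measure R]_s (H s)%:E = 0)%E.
Proof.
set mu := @lebesgue_measure R.
move=> dG cH intH intG.
have intN : mu.-integrable setT (EFin \o (Num.norm \o G)).
  exact: integrable_norm intG.
(* Each point is eventually outside the unit segments starting at [c n], so the integral [m n] of
   the absolute value of [G] over them tends to 0. *)
have small (c : R^nat) :
    (forall t, \forall n \near \oo, t < c n \/ c n + 1 < t) ->
  exists2 u : R^nat, forall n, c n <= u n <= c n + 1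
    & G (u n) @[n --> \oo] --> 0.
  move=> farc.
  pose m n := (\int[mu]_(t in `[c n, (c n + 1)%R]) `|G t|)%R.
  have intNc n : mu.-integrable `[c n, (c n + 1)%R] (EFin \o (Num.norm \o G)).
    exact: integrableS intN.
  have m0 : m n @[n --> \oo] --> 0.
    have : (\int[mu]_(t in `[c n, (c n + 1)%R]) (`|G t|%R)%:E @[n --> \oo] -->
        \int[mu]_(t in set0) (`|G t|%R)%:E)%E.
      apply: cvg_integral_setwise => // t; apply: filterS (farc t) => n h.
      by split => //=; rewrite in_itv/= => /andP[]; case: h; lra.
    rewrite integral_set0 => /fine_cvg; exact.
  (* On a segment of length 1 the integral [m n] is also a mean value, and the absolute value of [G]
     cannot exceed it by [n.+1%:R^-1] everywhere. *)
  have /choice[u uP] n : exists u, (c n <= u <= c n + 1) /\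
      `|G u| <= m n + n.+1%:R^-1.
    apply: contrapT => h.
    have : m n + n.+1%:R^-1 <= m n.
      have -> : m n + n.+1%:R^-1 =
          (\int[mu]_(t in `[c n, (c n + 1)%R]) (m n + n.+1%:R^-1))%R.
        rewrite Rintegral_cst//= lebesgue_measure_itv/= lte_fin ltrDl ltr01.
        by rewrite -EFinB/= addrAC subrr add0r mulr1.
      apply: le_Rintegral => //.
        apply: continuous_compact_integrable; first exact: segment_compact.
        by apply: continuous_subspaceT => x; exact: cst_continuous.
      move=> t /=; rewrite in_itv/= => ct; rewrite leNgt; apply/negP => Gt.
      by apply: h; exists t; split => //; exact: ltW.
    by rewrite gerDl leNgt invr_gt0 ltr0n.
  exists u; first by move=> n; case: (uP n).
  apply/norm_cvg0P.
  apply: (@squeeze_cvgr _ _ _ _ (cst 0) (fun n => m n + n.+1%:R^-1)).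
  - by apply: nearW => n /=; rewrite normr_ge0; case: (uP n).
  - exact: cvg_cst.
  - by rewrite -[X in _ --> X](addr0 0); apply: cvgD => //; exact: cvg_harmonic.
have [b bP Gb] : exists2 u : R^nat, forall n, n%:R <= u n <= n%:R + 1
    & G (u n) @[n --> \oo] --> 0.
  by apply: small => t; apply: filterS (nbhs_infty_gtr t) => n; left.
(* The shift by 2 puts the left segment strictly before the right one even for [n = 0], whence
   [a n < b n] for all [n]. *)
have [a aP Ga] : exists2 u : R^nat,
    forall n, - n%:R - 2 <= u n <= - n%:R - 2 + 1
    & G (u n) @[n --> \oo] --> 0.
  apply: small => t; apply: filterS (nbhs_infty_gtr (- t)) => n ?; right; lra.
apply: (@integral_derive_exhaust _ setT G H (fun s _ => dG s)
  (fun s _ => cH s) a b) => //.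
- move=> n; have := aP n; have := bP n; have : (0 : R) <= n%:R by []; lra.
- move=> s _; near=> n.
  have ? : - s < n%:R by near: n; exact: nbhs_infty_gtr.
  have ? : s < n%:R by near: n; exact: nbhs_infty_gtr.
  have := aP n; have := bP n; lra.
- by rewrite -[X in _ --> X](subrr 0); apply: cvgB.
Unshelve. all: by end_near. Qed.

(** * Integration along coordinate lines of a product *)

Section tuple_lines.
Context d (T : measurableType d) (R : realType).
Variable mu : {sigma_finite_measure set T -> \bar R}.

Definition upd n (i : 'I_n) (s : T) (u : n.-tuple T) : n.-tuple T :=
  [tuple if k == i then s else tnth u k | k < n].

Lemma tnth_upd n (i : 'I_n) s u k :
  tnth (upd i s u) k = if k == i then s else tnth u k.
Proof. by rewrite tnth_mktuple. Qed.

Lemma upd_tcons0 n s t (u : n.-tuple T) :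
  upd ord0 s (tcons (t, u)) = tcons (s, u).
Proof.
apply: eq_from_tnth => k; rewrite tnth_upd; case: (unliftP ord0 k) => [j ->|->].
  by rewrite !tnthS.
by rewrite eqxx tnth0.
Qed.

Lemma upd_tconsS n (j : 'I_n) s t (u : n.-tuple T) :
  upd (lift ord0 j) s (tcons (t, u)) = tcons (t, upd j s u).
Proof.
apply: eq_from_tnth => k; rewrite tnth_upd; case: (unliftP ord0 k) => [l ->|->].
  by rewrite (inj_eq lift_inj) !tnthS tnth_upd.
by rewrite !tnth0.
Qed.

Lemma integrable_tcons n (h : n.+1.-tuple T -> R) :
  (tuple_measure mu n.+1).-integrable setT (EFin \o h) ->
  (mu \x tuple_measure mu n)%E.-integrable setT (EFin \o (h \o @tcons _ T n)).
Proof.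
move=> /integrableP[mh hoo]; apply/integrableP; split.
  by apply: (measurableT_comp mh); exact: measurable_tcons.
move: hoo; rewrite (@ge0_integral_pushforward _ _ _ _ _ _
  (@measurable_tcons _ T n) (mu \x tuple_measure mu n)%E setT)//.
by apply: measurableT_comp mh.
Qed.

Lemma integral_tcons n (h : n.+1.-tuple T -> R) :
  (tuple_measure mu n.+1).-integrable setT (EFin \o h) ->
  (\int[tuple_measure mu n.+1]_u (h u)%:E =
   \int[mu \x tuple_measure mu n]_p (h (tcons p))%:E)%E.
Proof.
move=> ih; have [mh _] := integrableP _ _ _ ih.
rewrite (@integral_pushforward _ _ _ _ _ _ (@measurable_tcons _ T n)
  (mu \x tuple_measure mu n)%E setT)//.
exact: integrable_tcons.
Qed.

(* [g] serves to transmit to almost every line the integrability of a function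
   other than the integrand, typically a primitive of it. *)
Lemma integral_lines_eq0 n (i : 'I_n) (h g : n.-tuple T -> R) :
  (tuple_measure mu n).-integrable setT (EFin \o h) ->
  (tuple_measure mu n).-integrable setT (EFin \o g) ->
  (forall u, mu.-integrable setT (fun s => (h (upd i s u))%:E) ->
     mu.-integrable setT (fun s => (g (upd i s u))%:E) ->
     (\int[mu]_s (h (upd i s u))%:E = 0)%E) ->
  (\int[tuple_measure mu n]_u (h u)%:E = 0)%E.
Proof.
elim: n => [|n IHn] in i h g *; first by case: i.
move=> ih ig hg0; rewrite integral_tcons//.
have := integrable_tcons ih; set h' := EFin \o _ => ih'.
have := integrable_tcons ig; set g' := EFin \o _ => ig'.
(* If [i] is not the first coordinate, the tail is integrated first and the induction hypothesis
   applies for almost every head. If it is, the head is integrated first and the inner integral is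
   itself a line integral. *)
case: (unliftP ord0 i) => [j|] iE; subst i.
  transitivity (\int[mu]_t fubini_F (tuple_measure mu n) h' t)%E.
    by rewrite integral12_prod_meas1.
  rewrite -(@integral0 _ _ _ mu setT); apply: ae_eq_integral => //.
  - exact: measurable_fubini_F ih'.
  - move: (ae_integrable1 ih') (ae_integrable1 ig').
    apply: filterS2 => t iht igt _.
    apply: (IHn j _ (fun u => g (tcons (t, u)))) => //.
    move=> u; have := hg0 (tcons (t, u)).
    have updE (f : n.+1.-tuple T -> R) :
        (fun s => (f (upd (lift ord0 j) s (tcons (t, u))))%:E) =
        (fun s => (f (tcons (t, upd j s u)))%:E).
      by apply/funext => s; rewrite upd_tconsS.
    by rewrite !updE.
transitivity (\int[tuple_measure mu n]_u fubini_G mu h' u)%E.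
  by rewrite integral21_prod_meas1.
rewrite -(@integral0 _ _ _ (tuple_measure mu n) setT).
apply: ae_eq_integral => //.
- exact: measurable_fubini_G ih'.
- move: (ae_integrable2 ih') (ae_integrable2 ig').
  (* The head [point] is arbitrary: [upd ord0] overwrites it. *)
  apply: filterS2 => u ihu igu _; have := hg0 (tcons (point, u)).
  have updE (f : n.+1.-tuple T -> R) :
      (fun s => (f (upd ord0 s (tcons (point, u))))%:E) =
      (fun s => (f (tcons (s, u)))%:E).
    by apply/funext => s; rewrite upd_tcons0.
  by rewrite !updE; exact.
Qed.

End tuple_lines.

(** * Fubini on rectangles and Borel sets of tuples *)

Section fubini_on_rectangle.
Context d1 d2 (T1 : measurableType d1) (T2 : measurableType d2) (R : realType).
Variable m1 : {sigma_finite_measure set T1 -> \bar R}.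
Variable m2 : {sigma_finite_measure set T2 -> \bar R}.
Variables (D1 : set T1) (D2 : set T2).
Hypotheses (mD1 : measurable D1) (mD2 : measurable D2).
Variable g : T1 -> T2 -> R.
Hypothesis ig :
  (m1 \x m2)%E.-integrable (D1 `*` D2) (fun p => (g p.1 p.2)%:E).

(** Extension by 0 reduces Fubini on a rectangle to Fubini on the whole product; a section of [h] is
    a section of [g] extended by 0, or identically 0. *)
Let h := (fun p => (g p.1 p.2)%:E) \_ (D1 `*` D2).

Let ih : (m1 \x m2)%E.-integrable setT h.
Proof. exact: (integrable_mkcond _ (measurableX mD1 mD2)).1. Qed.

Let hE x : D1 x -> (fun y => h (x, y)) = (fun y => (g x y)%:E) \_ D2.
Proof.
move=> Dx; apply/funext => y; rewrite /h !patchE; congr (if _ then _ else _).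
by apply/idP/idP => /set_mem => [[_ D2y]|D2y]; exact/mem_set.
Qed.

Let hE0 x : ~ D1 x -> (fun y => h (x, y)) = cst 0%E.
Proof. by move=> Dx; apply/funext => y; rewrite /h patchE memNset// => -[]. Qed.

Let FE : fubini_F m2 h = (fun x => \int[m2]_(y in D2) (g x y)%:E)%E \_ D1.
Proof.
apply/funext => x; rewrite patchE; case: ifPn => [/set_mem Dx|].
  by rewrite /fubini_F hE// -integral_mkcond.
by rewrite notin_setE => Dx; rewrite /fubini_F hE0// integral0.
Qed.

Let iF : m1.-integrable D1 (fun x => \int[m2]_(y in D2) (g x y)%:E)%E.
Proof.
by apply: (integrable_mkcond _ mD1).2; rewrite -FE; exact: integrable_fubini_F.
Qed.

Lemma ae_integrable_section :
  {ae m1, forall x, D1 x -> m2.-integrable D2 (fun y => (g x y)%:E)}.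
Proof.
move: (ae_integrable1 ih); apply: filterS => x + Dx.
by rewrite hE//; exact: (integrable_mkcond _ mD2).2.
Qed.

(** Taking the real part [fine] of the inner integral sends infinite values to 0, which can only
    decrease the absolute value. *)
Lemma integrable_Rintegral_section :
  m1.-integrable D1 (fun x => (\int[m2]_(y in D2) g x y)%:E).
Proof.
have [mF _] := integrableP _ _ _ iF.
apply: le_integrable iF => //.
  by apply/measurable_EFinP; exact: measurableT_comp mF.
by move=> x _; rewrite /Rintegral; case: (integral _ _ _) => //= *; exact: leey.
Qed.

(** The inner integral, being integrable in [x], is finite almost everywhere, so applying [fine] to
    it changes it only on a null set. *)
Lemma Rintegral_section :
  (\int[m1]_(x in D1) \int[m2]_(y in D2) g x y =
   \int[(m1 \x m2)%E]_(p in D1 `*` D2) g p.1 p.2)%R.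
Proof.
have [mF _] := integrableP _ _ _ iF.
have [mF' _] := integrableP _ _ _ integrable_Rintegral_section.
congr fine; rewrite [RHS]integral_mkcond -(integral12_prod_meas1 ih) FE.
rewrite -integral_mkcond; apply: ae_eq_integral => //.
by apply: filterS (integrable_ae mD1 iF) => x + Dx => /(_ Dx) /fineK.
Qed.

End fubini_on_rectangle.

Section fubini_swap.
Context d1 d2 (T1 : measurableType d1) (T2 : measurableType d2) (R : realType).
Variable m1 : {sigma_finite_measure set T1 -> \bar R}.
Variable m2 : {sigma_finite_measure set T2 -> \bar R}.
Variables (D1 : set T1) (D2 : set T2).
Hypotheses (mD1 : measurable D1) (mD2 : measurable D2).

(** Fubini with [x] integrated first. It serves for the transport term, whose integral over
    positions vanishes at fixed velocity. *)
Lemma Rintegral_product_eq0 (g : T1 -> T2 -> R) :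
  (m1 \x m2)%E.-integrable (D1 `*` D2) (fun p => (g p.1 p.2)%:E) ->
  (forall y, D2 y -> m1.-integrable D1 (fun x => (g x y)%:E) ->
     (\int[m1]_(x in D1) g x y = 0)%R) ->
  (\int[(m1 \x m2)%E]_(p in D1 `*` D2) g p.1 p.2 = 0)%R.
Proof.
move=> ig g0; rewrite /Rintegral integral_mkcond.
set h := _ \_ _.
have ih : (m1 \x m2)%E.-integrable setT h.
  exact: (integrable_mkcond _ (measurableX mD1 mD2)).1.
have hE y : D2 y -> (fun x => h (x, y)) = (fun x => (g x y)%:E) \_ D1.
  move=> Dy; apply/funext => x; rewrite /h !patchE; congr (if _ then _ else _).
  by apply/idP/idP => /set_mem => [[D1x _]|D1x]; exact/mem_set.
rewrite -(integral21_prod_meas1 ih).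
suff -> : (\int[m2]_y fubini_G m1 h y = \int[m2]_y cst 0 y)%E.
  by rewrite integral0.
apply: ae_eq_integral => //; first exact: measurable_fubini_G ih.
move: (ae_integrable2 ih); apply: filterS => y ihy _; rewrite /fubini_G.
have [Dy|nDy] := pselect (D2 y).
  have igy : m1.-integrable D1 (fun x => (g x y)%:E).
    by apply: (integrable_mkcond _ mD1).2; rewrite -hE.
  rewrite hE// -integral_mkcond -[LHS]fineK ?integrable_fin_num//.
  by have := g0 _ Dy igy; rewrite /Rintegral => ->.
by rewrite integral0_eq// => x _; rewrite /h patchE memNset// => -[].
Qed.

End fubini_swap.

Section euclidean_tuples.
Context {R : realType}.

Lemma measurable_tuple_box n (a b : 'I_n -> R) :
  measurable [set t : n.-tuple (measurableTypeR R) |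
    forall i, a i <= tnth t i <= b i].
Proof.
rewrite (_ : mkset _ = \bigcap_(i in [set: 'I_n])
    ((@tnth _ (measurableTypeR R) ^~ i) @^-1` `[a i, b i])).
  apply: fin_bigcap_measurable => // i _.
  by rewrite -[X in measurable X]setTI; exact: measurable_tnth.
apply/seteqP; split => t tB i; first by move=> _ /=; rewrite in_itv/=.
by have := tB i I; rewrite /= in_itv.
Qed.

Lemma lebesgue_tuple_box n (a b : 'I_n -> R) :
  (lebesgue_tuple R n [set t | forall i, (a i <= tnth t i <= b i)%R] < +oo)%E.
Proof.
elim: n a b => [|n IHn] a b.
  by rewrite /lebesgue_tuple /= diracE ltry.
pose B := [set t : n.-tuple (measurableTypeR R) |
  forall i, (a (lift ord0 i) <= tnth t i <= b (lift ord0 i))%R].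
have mB : measurable B by exact: measurable_tuple_box.
have fab : lebesgue_measure (`[a ord0, b ord0] : set R) \is a fin_num.
  by rewrite lebesgue_measure_itv/=; case: ifP.
rewrite /lebesgue_tuple /= /tcons_measure /pushforward.
rewrite [X in (_ \x _)%E X](_ : _ = `[a ord0, b ord0] `*` B).
  rewrite product_measure1E// lte_mul_pinfty//.
  exact: IHn.
apply/seteqP; split => [[s u] suB|[s u] [/= sab uB] i].
  split; first by rewrite /= in_itv/=; have := suB ord0; rewrite tnth0.
  by move=> i; have := suB (lift ord0 i); rewrite tnthS.
case: (unliftP ord0 i) => [j ->|->]; first by rewrite tnthS; exact: uB.
by rewrite tnth0; move: sab; rewrite in_itv.
Qed.

Variable n : nat.
Notation T := (measurableTypeR R).

(** For the sup norm, an open set is the union of the countably many open cubes with rational centre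
    and radius that it contains. Each cube is a finite intersection of preimages of intervals under
    coordinates. *)
Lemma measurable_row_of_tuple_open (W : set 'rV[R]_n) :
  open W -> measurable (@row_of_tuple R n @^-1` W).
Proof.
move=> oW.
pose B (p : 'rV[rat]_n * rat) : set (n.-tuple T) :=
  \bigcap_(i in [set: 'I_n]) ((@tnth _ T ^~ i) @^-1`
     `]ratr (p.1 0 i) - ratr p.2, ratr (p.1 0 i) + ratr p.2[).
have mB p : measurable (B p).
  apply: fin_bigcap_measurable => // i _.
  by rewrite -[X in measurable X]setTI; exact: measurable_tnth.
rewrite [X in measurable X](_ : _ = \bigcup_p
    if `[< B p `<=` @row_of_tuple R n @^-1` W >] then B p else set0).
  apply: countable_bigcupT_measurable => [|p]; first exact: countableP.
  by case: ifP => _; [exact: mB|exact: measurable0].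
apply/seteqP; split => [t Wt|t [p _]]; last first.
  by case: ifP => // /asboolP; exact.
have Wn : nbhs (row_of_tuple t) W by apply: open_nbhs_nbhs; split.
have [e /= e0 eW] := (nbhs_ballP (row_of_tuple t) W).1 Wn.
(* Two points of a cube of radius [r] differ by less than [2 * r] in each coordinate, so a cube
   containing [t] stays in the ball of radius [e] around it. *)
have [r /andP[r0 re]] : exists r : rat, 0 < (ratr r : R) < e / 2.
  have /rat_in_itvoo[r] : 0 < e / 2 by rewrite divr_gt0.
  by rewrite in_itv/= => ?; exists r.
have /choice[q qP] i : exists q, tnth t i - ratr r < ratr q < tnth t i + ratr r.
  have /rat_in_itvoo[q] : tnth t i - ratr r < tnth t i + ratr r by lra.
  by rewrite in_itv/= => ?; exists q.
exists (\row_i q i, r) => //; rewrite ifT.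
  by move=> i _ /=; rewrite in_itv/= mxE; have := qP i; lra.
apply/asboolP => u Bu; apply: eW; split=> // j i; rewrite !mxE.
have := Bu i I; rewrite /= in_itv/= mxE; have := qP i.
by rewrite /ball/= ltr_norml; lra.
Qed.

Lemma measurable_continuous_row (g : 'rV[R]_n -> R) : continuous g ->
  measurable_fun setT (g \o @row_of_tuple R n).
Proof.
move=> /continuousP cg; apply: (measurability _ (RGenOpens.measurableE R)).
move=> _ [_ [a [b ->] <-]]; rewrite setTI comp_preimage.
by apply: measurable_row_of_tuple_open; apply: cg; apply: interval_open.
Qed.

End euclidean_tuples.

(** * Integration by parts in several variables *)

Section has_integral.
Context d (T : measurableType d) (R : realType).
Variables (mu : {measure set T -> \bar R}) (D : set T).
Hypothesis mD : measurable D.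
Implicit Types (f g : T -> R) (c k : R).

(** Integrability and value are bundled, so that linearity carries both at once through the long
    sums of the energy balance. *)
Definition has_integral f c :=
  mu.-integrable D (EFin \o f) /\ (\int[mu]_(t in D) f t = c)%R.

Lemma eq_has_integral f g c :
  (forall t, D t -> f t = g t) -> has_integral f c -> has_integral g c.
Proof.
move=> fg [If <-]; split.
  by apply: eq_integrable If => // t /set_mem Dt; rewrite /= fg.
by apply: eq_Rintegral => t /set_mem Dt; rewrite fg.
Qed.

Lemma has_integralD f g c k : has_integral f c -> has_integral g k ->
  has_integral (fun t => f t + g t) (c + k).
Proof.
move=> [If <-] [Ig <-]; split; last by rewrite RintegralD.
exact: integrableD If Ig.
Qed.

Lemma has_integralZ k f c :
  has_integral f c -> has_integral (fun t => k * f t) (k * c).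
Proof.
by move=> [If <-]; split; [exact: (integrableZl mD k If)|rewrite RintegralZl].
Qed.

Lemma has_integral0 : has_integral (fun=> 0) 0.
Proof. by split; [exact: integrable0|rewrite Rintegral_cst// mul0r]. Qed.

Lemma has_integral_sum (I : Type) (s : seq I) (f : I -> T -> R) (c : I -> R) :
  (forall i, has_integral (f i) (c i)) ->
  has_integral (fun t => \sum_(i <- s) f i t) (\sum_(i <- s) c i).
Proof.
move=> fc; elim: s => [|i s IHs].
  rewrite big_nil; apply: eq_has_integral has_integral0 => t _.
  by rewrite big_nil.
rewrite big_cons; apply: eq_has_integral (has_integralD (fc i) IHs) => t _.
by rewrite big_cons.
Qed.

End has_integral.

(** * Lines parallel to a coordinate axis *)

Section coordinate_lines.
Context {R : realType} {d : nat}.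
Notation T := (measurableTypeR R).
Implicit Types (i : 'I_d) (u : d.-tuple T) (s : R).

Definition line i u s : 'rV[R]_d := row_of_tuple (upd i (s : T) u).

Lemma lineE i u s k : line i u s 0 k = if k == i then s else tnth u k.
Proof. by rewrite mxE tnth_upd. Qed.

Lemma line_shift i u s h : line i u (h + s) = h *: basis_vec i + line i u s.
Proof.
apply/rowP => k; rewrite !(lineE, mxE) eqxx /= eq_sym.
by case: eqVneq => _; rewrite ?mulr1// mulr0 add0r.
Qed.

Lemma continuous_line i u : continuous (line i u).
Proof.
move=> s; have -> : line i u = (fun t => t *: basis_vec i + line i u 0).
  by apply/funext => t; rewrite -line_shift addr0.
by apply: cvgD; [apply: cvgZr_tmp; exact: cvg_id|exact: cvg_cst].
Qed.

Lemma is_derive_line (g : 'rV[R]_d -> R) i u s :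
  derivable g (line i u s) (basis_vec i) ->
  is_derive s (1 : R) (g \o line i u) ('D_(basis_vec i) g (line i u s)).
Proof.
have E : (fun h => h^-1 *: (((g \o line i u) \o shift s) (h *: 1) -
      (g \o line i u) s)) =
    (fun h => h^-1 *: ((g \o shift (line i u s)) (h *: basis_vec i) -
      g (line i u s))).
  by apply/funext => h; rewrite /= line_shift [_ *: 1]mulr1.
by move=> dg; split; [rewrite /derivable E|rewrite /derive E].
Qed.

Lemma dotv_line i u s : dotv (line i u s) (line i u s) =
  s ^+ 2 + \sum_(k | k != i) tnth u k * tnth u k.
Proof.
rewrite /dotv (bigD1 i)//= !lineE eqxx -expr2; congr (_ + _).
by apply: eq_bigr => k /negbTE ki; rewrite !lineE ki.
Qed.

Lemma is_derive_dotv_line i u s : is_derive s (1 : R)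
  (fun t => dotv (line i u t) (line i u t)) (2 * s).
Proof.
under eq_fun do rewrite dotv_line.
apply: is_derive_eq; rewrite addr0 /GRing.scale/=; lra.
Qed.

Lemma normr_coord (x : 'rV[R]_d) i : `|x 0 i| <= `|x|.
Proof.
rewrite [leRHS]/Num.Def.normr /= mx_normrE; apply/bigmax_geP; right => /=.
by exists (0, i).
Qed.

End coordinate_lines.

Section coordinate_integration.
Context {R : realType} {d : nat}.
Notation T := (measurableTypeR R).
Notation mu := (@lebesgue_measure R).
Notation mud := (lebesgue_tuple R d).
Implicit Types (i : 'I_d) (u : d.-tuple T) (s : R).

Lemma measurable_box (a b : 'rV[R]_d) :
  measurable (@row_of_tuple R d @^-1` box a b).
Proof.
rewrite (_ : _ @^-1` _ = [set t | forall i, a 0 i <= tnth t i <= b 0 i]).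
  exact: measurable_tuple_box.
by apply/seteqP; split => t tab i; have := tab i; rewrite /= mxE.
Qed.

(** The box is compact and has finite measure, and [g] is bounded on it. *)
Lemma integrable_over_box_continuous (a b : 'rV[R]_d) (g : 'rV[R]_d -> R) :
  continuous g -> integrable_over (box a b) g.
Proof.
move=> cg; have mB := measurable_box a b.
apply: (@measurable_bounded_integrable _ _ _ _ (g \o @row_of_tuple R d)) => //.
- apply: le_lt_trans (lebesgue_tuple_box (a 0) (b 0)).
  apply: le_measure; rewrite ?inE//; first exact: measurable_tuple_box.
  by move=> t tab i; have := tab i; rewrite mxE.
- by apply: measurable_funTS; exact: measurable_continuous_row.
- have : bounded_set (g @` box a b).
    apply: compact_bounded; apply: continuous_compact.
      exact: continuous_subspaceT.
    rewrite (_ : box a b = [set x | forall i, `[a 0 i, b 0 i]%classic (x 0 i)]).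
      by apply: (@rV_compact _ _ (fun i => `[a 0 i, b 0 i]%classic)) => i;
        exact: segment_compact.
    by apply/seteqP; split => x xab i; have := xab i; rewrite /= in_itv.
  move=> [M [Mr gM]]; exists M; split => // x /gM gx t /= tab.
  by apply: gx; exists (row_of_tuple t).
Qed.

(** [integral_lines_eq0] applied to the extensions by 0 outside [D]: integrals over lines become
    integrals over the slices [U] of [D]. *)
Lemma Rintegral_lines_eq0 i (D : set 'rV[R]_d) (h g : 'rV[R]_d -> R) :
  measurable (@row_of_tuple R d @^-1` D) ->
  integrable_over D h -> integrable_over D g ->
  (forall u, let U := [set s : R | D (line i u s)] in measurable (U : set T) ->
     mu.-integrable U (fun s => (h (line i u s))%:E) ->
     mu.-integrable U (fun s => (g (line i u s))%:E) ->
     (\int[mu]_(s in U) (h (line i u s))%:E = 0)%E) ->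
  int_over D h = 0.
Proof.
move=> mD ih ig hg0; rewrite /int_over /Rintegral.
have lift (f : 'rV[R]_d -> R) : integrable_over D f -> mud.-integrable setT
    (EFin \o ((f \o @row_of_tuple R d) \_ (@row_of_tuple R d @^-1` D))).
  by move=> If; rewrite -restrict_EFin; exact: (integrable_mkcond _ mD).1.
have lineP (f : 'rV[R]_d -> R) u :
    (fun s => (((f \o @row_of_tuple R d) \_ (@row_of_tuple R d @^-1` D))
                 (upd i (s : T) u))%:E) =
    (fun s => (f (line i u s))%:E) \_ [set s : R | D (line i u s)].
  apply/funext => s; rewrite !patchE /=.
  have -> : (upd i (s : T) u \in @row_of_tuple R d @^-1` D) =
      (s \in [set s : R | D (line i u s)]).
    by apply/idP/idP => /set_mem Ds; exact/mem_set.
  by case: ifP.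
rewrite integral_mkcond; under eq_integral do rewrite restrict_EFin /=.
rewrite (integral_lines_eq0 (i := i) (lift _ ih) (lift _ ig))// => u.
rewrite !lineP.
have mU : measurable ([set s : R | D (line i u s)] : set T).
  have mupd : measurable_fun setT (fun s : T => upd i s u).
    apply: (measurable_fun_tnthP _).2 => k.
    rewrite (_ : _ \o _ = fun s : T => if k == i then s else tnth u k).
      by case: (k == i); [exact: measurable_id|exact: measurable_cst].
    by apply/funext => s /=; rewrite tnth_upd.
  rewrite -[X in measurable X]setTI; exact: (mupd measurableT _ mD).
by move=> /(integrable_mkcond _ mU).2 ihu /(integrable_mkcond _ mU).2 igu;
  rewrite -integral_mkcond; apply: hg0.
Qed.

End coordinate_integration.

Section integration_by_parts.
Context {R : realType} {d : nat}.
Notation T := (measurableTypeR R).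
Notation mu := (@lebesgue_measure R).
Implicit Types (i : 'I_d) (g : 'rV[R]_d -> R).

(** A slice of the box is empty or the full segment from [a 0 i] to [b 0 i], at whose ends [g] takes
    the same value by periodicity. The factor [k] is there for velocity weights, constant in
    position. *)
Lemma int_over_box_derive (a b : 'rV[R]_d) g i (k : R) :
  a 0 i < b 0 i ->
  (forall x, derivable g x (basis_vec i)) ->
  continuous (fun x => 'D_(basis_vec i) g x) ->
  Defs.periodic a b g ->
  integrable_over (box a b) (fun x => k * 'D_(basis_vec i) g x) ->
  int_over (box a b) (fun x => k * 'D_(basis_vec i) g x) = 0.
Proof.
move=> ab dg cg pg ig.
apply: (Rintegral_lines_eq0 (i := i) (measurable_box a b) ig ig) => u /= _ _ _.
have [uP|uP] := pselect (forall j, j != i -> a 0 j <= tnth u j <= b 0 j);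
  last first.
  rewrite (_ : mkset _ = set0) ?integral_set0//.
  rewrite -subset0 => s /= abs; apply: uP => j /negbTE ji.
  by have := abs j; rewrite lineE ji.
rewrite (_ : mkset _ = `[a 0 i, b 0 i]%classic); last first.
  apply/seteqP; split => s /=; rewrite in_itv/=.
    by move=> /(_ i); rewrite lineE eqxx.
  by move=> sab j; rewrite lineE; case: eqVneq => [->|/uP].
have dG s : setT s -> is_derive s (1 : R) (k \*: (g \o line i u))
    (k * 'D_(basis_vec i) g (line i u s)).
  by move=> _; apply: is_deriveZ; exact: is_derive_line.
have cH s : setT s ->
    {for s, continuous (fun s => k * 'D_(basis_vec i) g (line i u s))}.
  move=> _; have := @continuous_comp _ _ _ (line i u) _ s
    (@continuous_line _ _ i u s) (cg _).
  exact: cvgMl_tmp.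
rewrite (integral_segment_derive dG cH ab)// -EFinB /=.
have -> : line i u (b 0 i) =
    line i u (a 0 i) + (b 0 i - a 0 i) *: basis_vec i.
  by rewrite addrC -line_shift subrK.
by rewrite pg subrr.
Qed.

(** The function [h] of the proof is the derivative of [g v * dotv v v] along axis [i], and its
    integral vanishes line by line. For bounded [W] this primitive tends to 0 at the boundary of
    each slice; for the whole space it is integrable on almost every line, which is why [i2]
    accompanies [ih]. *)
Lemma int_over_moment (W : set 'rV[R]_d) g i :
  velocity_domain W ->
  {within closure W, continuous g} ->
  (forall v, W v -> derivable g v (basis_vec i)) ->
  (forall v, W v -> {for v, continuous (fun v => 'D_(basis_vec i) g v)}) ->
  (forall v, boundary W v -> g v = 0) ->
  integrable_over W (fun v => 'D_(basis_vec i) g v * dotv v v) ->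
  integrable_over W (fun v => g v * dotv v v) ->
  integrable_over W (fun v => g v * v 0 i) ->
  int_over W (fun v => 'D_(basis_vec i) g v * dotv v v) =
  - 2 * int_over W (fun v => g v * v 0 i).
Proof.
move=> vW /subspace_continuousP cg dg cDg bg iD i2 i1.
have oW : open W by case: vW => [[]|->] //; exact: openT.
have mW := measurable_row_of_tuple_open oW.
pose h v := 'D_(basis_vec i) g v * dotv v v + 2 * (g v * v 0 i).
have [ih hE] : has_integral (lebesgue_tuple R d) (@row_of_tuple R d @^-1` W)
    (h \o @row_of_tuple R d)
    (int_over W (fun v => 'D_(basis_vec i) g v * dotv v v) +
     2 * int_over W (fun v => g v * v 0 i)).
  by apply: has_integralD => //; apply: has_integralZ.
suff : int_over W h = 0 by rewrite [int_over _ _]hE; lra.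
apply: (Rintegral_lines_eq0 (i := i) mW ih i2) => u U mU ihU igU.
pose G s := g (line i u s) * dotv (line i u s) (line i u s).
pose H s := h (line i u s).
have dG s : U s -> is_derive s (1 : R) G (H s).
  move=> Us; have := is_derive_line (dg _ Us) => d1.
  have := is_derive_dotv_line i u s => d2.
  apply: (is_derive_eq (is_deriveM d1 d2)).
  by rewrite /H /h /GRing.scale/= lineE eqxx; lra.
have c2 : continuous (fun s => dotv (line i u s) (line i u s)).
  move=> s; apply: differentiable_continuous; apply/derivable1_diffP.
  by case: (is_derive_dotv_line i u s).
have cH s : U s -> {for s, continuous H}.
  move=> Us; have cl := @continuous_line _ _ i u s.
  have c1 : {for s, continuous (g \o line i u)}.
    apply: differentiable_continuous; apply/derivable1_diffP.
    by case: (is_derive_line (dg _ Us)).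
  apply: cvgD.
    apply: cvgM (c2 s).
    exact: (@continuous_comp _ _ _ (line i u) _ s cl (cDg _ Us)).
  apply: cvgMl_tmp; apply: cvgM; first exact: c1.
  under eq_fun do rewrite lineE eqxx.
  by rewrite lineE eqxx; exact: cvg_id.
case: vW => [[_ _ _ [M [Mr WM]]]|WT]; last first.
  have UT : U = setT by apply/seteqP; split => // s _; rewrite /U /= WT.
  rewrite UT in ihU igU dG cH *.
  by apply: (integral_derive_line (G := G)) => // s; [exact: dG|exact: cH].
have oU : open U.
  by move/continuousP: (@continuous_line _ _ i u); apply.
have UM s : U s -> `|s| <= `|M| + 1.
  move=> Us; have := WM (`|M| + 1) _ _ Us.
  move=> /(_ (le_lt_trans (ler_norm _) _)); rewrite ltrDl => /(_ ltr01).
  by apply: le_trans; have := normr_coord (line i u s) i; rewrite lineE eqxx.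
apply: (integral_derive_bounded oU dG cH) => //.
- by exists (- (`|M| + 1)) => s /UM; rewrite ler_norml => /andP[].
- by exists (`|M| + 1) => s /UM; rewrite ler_norml => /andP[].
(* A boundary point of the slice is a boundary point of [W], where [g] vanishes; continuity of [g]
   up to the boundary gives the limit 0. *)
move=> s cUs nUs.
have cl : closure W (line i u s).
  move=> B /(@continuous_line _ _ i u s) /cUs[t [Ut Bt]].
  by exists (line i u t).
have g0 : g (line i u s) = 0.
  apply: bg; split => //; apply: contra_not nUs; exact: interior_subset.
rewrite -[X in _ --> X](mul0r (dotv (line i u s) (line i u s))).
apply: cvgM; last first.
  by apply: cvg_within_filter; exact: c2.
rewrite -g0.
have cgl : g x @[x --> within (closure W) (nbhs (line i u s))] -->
  g (line i u s) := cg _ cl.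
apply: cvg_comp cgl => B BW.
have BWs : \forall t \near s, closure W (line i u t) -> B (line i u t).
  exact: (@continuous_line _ _ i u s _ BW).
suff : \forall t \near s, U t -> B (line i u t) by [].
by apply: filterS BWs => t Bt Ut; apply: Bt; exact: subset_closure.
Qed.

End integration_by_parts.

(** * Energy balance of the schemes *)

Section energy.
Context {R : realType} {d : nat}.
Notation mud := (lebesgue_tuple R d).
Notation row := (@row_of_tuple R d).
Variables (a b : 'rV[R]_d) (Wv : set 'rV[R]_d).
Hypothesis ab : forall i, a 0 i < b 0 i.
Hypothesis vW : velocity_domain Wv.
Implicit Types (f : @distribution_fun R d) (E : @field_fun R d).
Implicit Types (s : @state R d).

Let oW : open Wv.
Proof. by case: vW => [[]|->] //; exact: openT. Qed.

Let mD : measurable (row @^-1` box a b) := measurable_box a b.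
Let mW : measurable (row @^-1` Wv) := measurable_row_of_tuple_open oW.
Let mDW : measurable ((row @^-1` box a b) `*` (row @^-1` Wv)) :=
  measurableX mD mW.

Let gradE (g : 'rV[R]_d -> R) x i : grad g x 0 i = 'D_(basis_vec i) g x.
Proof. by rewrite mxE. Qed.

Let ae_integrable_over g : integrable_over2 (box a b) Wv g ->
  {ae mud, forall t, (row @^-1` box a b) t -> integrable_over Wv (g (row t))}.
Proof. exact: (@ae_integrable_section _ _ _ _ _ mud mud _ _ mD mW
  (fun t u => g (row t) (row u))). Qed.

Let integrable_int_over g : integrable_over2 (box a b) Wv g ->
  integrable_over (box a b) (fun x => int_over Wv (g x)).
Proof. exact: (@integrable_Rintegral_section _ _ _ _ _ mud mud _ _ mD mW
  (fun t u => g (row t) (row u))). Qed.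

Let int_over_int_over g : integrable_over2 (box a b) Wv g ->
  int_over (box a b) (fun x => int_over Wv (g x)) =
  (\int[(mud \x mud)%E]_(p in (row @^-1` box a b) `*` (row @^-1` Wv))
     g (row p.1) (row p.2))%R.
Proof. exact: (@Rintegral_section _ _ _ _ _ mud mud _ _ mD mW
  (fun t u => g (row t) (row u))). Qed.

(** The part of [admissible] about the distribution alone, so that the kinetic balance can be stated
    with an arbitrary field, in particular 0. *)
Definition admissible_f f : Prop :=
  [/\ forall v, closure Wv v -> Defs.periodic a b (f^~ v),
      vanishing_f Wv f, smooth_f Wv f & decay_f a b Wv f].

Definition kinetic f : R :=
  int_over (box a b) (fun x => int_over Wv (fun v => f x v * dotv v v)).

Definition field_energy E : R := int_over (box a b) (fun x => dotv (E x) (E x)).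

Definition has_integral2 (g : 'rV[R]_d -> 'rV[R]_d -> R) (c : R) : Prop :=
  has_integral (mud \x mud)%E ((row @^-1` box a b) `*` (row @^-1` Wv))
    (fun p => g (row p.1) (row p.2)) c.

Lemma has_integral2_kinetic f : admissible_f f ->
  has_integral2 (fun x v => f x v * dotv v v) (kinetic f).
Proof.
move=> [_ _ _ [_ _ i2 _ _]]; split; first exact: i2.
exact/esym/int_over_int_over.
Qed.

Lemma has_integral2_transport f i : admissible_f f ->
  has_integral2 (fun x v => v 0 i * grad_x f x v 0 i * dotv v v) 0.
Proof.
move=> [pf _ [_ sf] [_ _ _ tf _]]; split; first exact: tf.
apply: (Rintegral_product_eq0 mD mW (g := fun t u =>
  row u 0 i * grad_x f (row t) (row u) 0 i * dotv (row u) (row u))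
  (tf i)) => y Wy.
set v := row y.
have E x : v 0 i * grad_x f x v 0 i * dotv v v =
    (v 0 i * dotv v v) * 'D_(basis_vec i) (f^~ v) x.
  by rewrite /grad_x gradE mulrAC.
under eq_fun do rewrite E.
move=> iy; rewrite (eq_Rintegral _ (g := fun t => (v 0 i * dotv v v) *
  'D_(basis_vec i) (f^~ v) (row t))) => [|t _]; last exact: E.
apply: int_over_box_derive => //.
- by move=> x; case: (sf x v Wy i).
- move=> x; have [_ _ c _] := sf x v Wy i.
  rewrite (_ : (fun _ => _) = (fun x => grad_x f x v 0 i)); last first.
    by apply/funext => z; rewrite /grad_x gradE.
  have cp : {for x, continuous (fun x : 'rV[R]_d => (x, v))}.
    move=> B [[B1 B2] [/= B1x B2v] sB].
    suff : \forall z \near x, B (z, v) by [].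
    apply: filterS B1x => z B1z; apply: (sB (z, v)); split => //.
    exact: nbhs_singleton.
  exact: (@continuous_comp _ _ _ (fun x => (x, v))
    (fun p => grad_x f p.1 p.2 0 i) x cp c).
- exact/pf/subset_closure.
Qed.

(** Only almost every position is reached: the second moments are assumed integrable over the
    product, and Fubini gives their sections almost everywhere. The factor [- 2] comes from
    differentiating [dotv v v]. *)
Lemma ae_has_integral_force f : admissible_f f ->
  {ae mud, forall t, (row @^-1` box a b) t -> forall i,
    has_integral mud (row @^-1` Wv)
      (fun u => grad_v f (row t) (row u) 0 i * dotv (row u) (row u))
      (- 2 * current Wv f (row t) 0 i)}.
Proof.
move=> [_ [bf _] [/subspace_continuousP cf sf] [jf _ kf _ ff]].
have aek := ae_integrable_over kf.
have aef : {ae mud, forall t i, (row @^-1` box a b) t ->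
    integrable_over Wv (fun v => grad_v f (row t) v 0 i * dotv v v)}.
  by apply: filter_forall => i; exact: ae_integrable_over (ff i).
apply: filterS2 aek aef => t kt ft Dt i; set x := row t.
have gE v : grad_v f x v 0 i = 'D_(basis_vec i) (f x) v by exact: gradE.
split; first exact: ft.
rewrite /current mxE -int_over_moment//.
- by apply: eq_Rintegral => u _; rewrite gE.
- apply/subspace_continuousP => v cWv.
  have cfv : f p.1 p.2 @[p --> within [set p | closure Wv p.2]
      (nbhs ((x, v) : ('rV[R]_d * 'rV[R]_d)%type))] --> f x v := cf (x, v) cWv.
  apply: (@cvg_comp _ _ _ (fun v => (x, v)) (fun p => f p.1 p.2)) cfv.
  move=> B [[B1 B2] [/= B1x B2v] sB].
  suff : \forall z \near v, closure Wv z -> B (x, z) by [].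
  apply: filterS B2v => z B2z cWz; apply: (sB (x, z)) => //; split => //.
  exact: nbhs_singleton.
- by move=> v Wv_; case: (sf x v Wv_ i).
- move=> v Wv_; have [_ _ _ c] := sf x v Wv_ i.
  rewrite (_ : (fun _ => _) = (fun v => grad_v f x v 0 i)); last first.
    by apply/funext => z; rewrite gE.
  have cp : {for v, continuous (fun v : 'rV[R]_d => (x, v))}.
    move=> B [[B1 B2] [/= B1x B2v] sB].
    suff : \forall z \near v, B (x, z) by [].
    apply: filterS B2v => z B2z; apply: (sB (x, z)); split => //.
    exact: nbhs_singleton.
  exact: (@continuous_comp _ _ _ (fun v => (x, v))
    (fun p => grad_v f p.1 p.2 0 i) v cp c).
- exact: bf.
- rewrite (_ : (fun _ => _) = (fun v => grad_v f x v 0 i * dotv v v)).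
    exact: ft.
  by apply/funext => v; rewrite gE.
- exact: kt.
Qed.

Lemma grad_x_avg f0 f1 x v i : admissible_f f0 -> admissible_f f1 -> Wv v ->
  grad_x (avg_f f0 f1) x v 0 i = 2^-1 * (grad_x f0 x v 0 i + grad_x f1 x v 0 i).
Proof.
move=> [_ _ [_ s0] _] [_ _ [_ s1] _] Wv_; rewrite /grad_x !gradE.
have [d0 _ _ _] := s0 x v Wv_ i; have [d1 _ _ _] := s1 x v Wv_ i.
rewrite (_ : (avg_f f0 f1)^~ v = 2^-1 \*: (f0^~ v + f1^~ v)); last first.
  by apply/funext => z; rewrite /avg_f mulrC.
by rewrite deriveZ ?deriveD//; exact: derivableD.
Qed.

Lemma grad_v_avg f0 f1 x v i : admissible_f f0 -> admissible_f f1 -> Wv v ->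
  grad_v (avg_f f0 f1) x v 0 i = 2^-1 * (grad_v f0 x v 0 i + grad_v f1 x v 0 i).
Proof.
move=> [_ _ [_ s0] _] [_ _ [_ s1] _] Wv_; rewrite /grad_v !gradE.
have [_ d0 _ _] := s0 x v Wv_ i; have [_ d1 _ _] := s1 x v Wv_ i.
rewrite (_ : avg_f f0 f1 x = 2^-1 \*: (f0 x + f1 x)); last first.
  by apply/funext => z; rewrite /avg_f mulrC.
by rewrite deriveZ ?deriveD//; exact: derivableD.
Qed.

(* [kappa] switches the transport term off (Scheme-b) or on, and [E = 0]
   switches the force term off (Scheme-a). *)
Lemma kinetic_step f0 f1 E (tau kappa : R) :
  admissible_f f0 -> admissible_f f1 -> tau != 0 ->
  (forall x v, Wv v ->
     (f1 x v - f0 x v) / tau + kappa * dotv v (grad_x (avg_f f0 f1) x v)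
     + dotv (E x) (grad_v (avg_f f0 f1) x v) = 0) ->
  integrable_over (box a b)
    (fun x => dotv (E x) (current Wv f0 x + current Wv f1 x)) ->
  kinetic f1 - kinetic f0 =
  tau * int_over (box a b)
          (fun x => dotv (E x) (current Wv f0 x + current Wv f1 x)).
Proof.
move=> a0 a1 tau0 vlasov iEJ.
pose P (x v : 'rV[R]_d) := \sum_i 2^-1 * (v 0 i * grad_x f0 x v 0 i * dotv v v
                           + v 0 i * grad_x f1 x v 0 i * dotv v v).
have IP : has_integral2 P 0.
  rewrite (_ : 0 = \sum_(i < d) 2^-1 * (0 + 0)); last first.
    by rewrite big1// => i _; rewrite addr0 mulr0.
  apply: has_integral_sum => // i; apply: has_integralZ => //.
  by apply: has_integralD => //; exact: has_integral2_transport.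
(* By the Vlasov equation, [S] is the force term times [dotv v v]. Writing it through the other
   terms yields its integrability over the product and one value of its integral; integrating the
   force term in velocity yields the other. *)
pose S (x v : 'rV[R]_d) :=
  - tau^-1 * (f1 x v * dotv v v + -1 * (f0 x v * dotv v v))
              + - kappa * P x v.
have IS : has_integral2 S (- tau^-1 * (kinetic f1 - kinetic f0)).
  rewrite -[X in has_integral2 _ X]addr0 -[X in _ + X](mulr0 (- kappa)).
  rewrite -(mulN1r (kinetic f0)).
  apply: has_integralD => //; last exact: has_integralZ.
  apply: has_integralZ => //; apply: has_integralD => //.
    exact: has_integral2_kinetic.
  by apply: has_integralZ => //; exact: has_integral2_kinetic.
have SE x v : Wv v -> S x v = \sum_i E x 0 i * (2^-1 *
    (grad_v f0 x v 0 i * dotv v v + grad_v f1 x v 0 i * dotv v v)).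
  move=> Wv_; have := vlasov x v Wv_.
  have -> : dotv (E x) (grad_v (avg_f f0 f1) x v) = \sum_i E x 0 i * (2^-1 *
      (grad_v f0 x v 0 i + grad_v f1 x v 0 i)).
    by apply: eq_bigr => i _; rewrite grad_v_avg.
  have PE : P x v = dotv v (grad_x (avg_f f0 f1) x v) * dotv v v.
    rewrite /P; set D := dotv v v; rewrite /dotv mulr_suml.
    apply: eq_bigr => i _.
    by rewrite grad_x_avg//; ring.
  have -> : \sum_i E x 0 i * (2^-1 * (grad_v f0 x v 0 i * dotv v v +
        grad_v f1 x v 0 i * dotv v v)) =
      (\sum_i E x 0 i * (2^-1 * (grad_v f0 x v 0 i + grad_v f1 x v 0 i))) *
      dotv v v.
    by rewrite mulr_suml; apply: eq_bigr => i _; ring.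
  move=> /eqP; rewrite addrC addr_eq0 => /eqP ->.
  by rewrite /S PE; ring.
have [iS Sint] := IS.
have iS2 : integrable_over2 (box a b) Wv S := iS.
pose X x := dotv (E x) (current Wv f0 x + current Wv f1 x).
have [iX' X'int] : has_integral mud (row @^-1` box a b)
    (fun t => -1 * X (row t)) (-1 * int_over (box a b) X).
  exact: has_integralZ.
(* The [2^-1] of the average cancels the 2 of the velocity moment, which leaves the factor [-1]. *)
have SX : int_over (box a b) (fun x => int_over Wv (S x)) =
    int_over (box a b) (fun x => -1 * X x).
  congr fine; apply: ae_eq_integral => //.
  - by case/integrableP: (integrable_int_over iS2).
  - by case/integrableP: iX'.
  apply: filterS2 (ae_has_integral_force a0) (ae_has_integral_force a1).
  move=> t F0 F1 Dt; congr EFin; set x := row t.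
  have [_ <-] : has_integral mud (row @^-1` Wv)
      (fun u => \sum_i E x 0 i * (2^-1 *
        (grad_v f0 x (row u) 0 i * dotv (row u) (row u) +
         grad_v f1 x (row u) 0 i * dotv (row u) (row u))))
      (-1 * X x).
    have -> : -1 * X x = \sum_i E x 0 i * (2^-1 *
        (- 2 * current Wv f0 x 0 i + - 2 * current Wv f1 x 0 i)).
      rewrite /X /dotv mulr_sumr; apply: eq_bigr => i _.
      by rewrite [in LHS]mxE; lra.
    apply: has_integral_sum => // i; do 2 apply: has_integralZ => //.
    by apply: has_integralD => //; [exact: F0|exact: F1].
  by apply: eq_Rintegral => u /set_mem; exact: SE.
have : - tau^-1 * (kinetic f1 - kinetic f0) = - int_over (box a b) X.
  by rewrite -Sint -int_over_int_over// SX [LHS]X'int mulN1r.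
by rewrite mulNr => /oppr_inj <-; rewrite mulrA mulfV// mul1r.
Qed.

Lemma continuous_dotv_self E : continuous E ->
  continuous (fun x => dotv (E x) (E x)).
Proof.
move=> cE; apply: continuous_big => [|i _ x]; first exact: add_continuous.
have c : {for x, continuous (fun x => E x 0 i)}.
  exact: (continuous_comp (cE x) (@coord_continuous _ _ _ _ _ _)).
exact: (@cvgM _ _ _ _ (fun x => E x 0 i) (fun x => E x 0 i) _ _ c c).
Qed.

Let admissible_fP s : admissible a b Wv s -> admissible_f s.1.
Proof. by case. Qed.

Lemma total_energyE s :
  total_energy a b Wv s = 2^-1 * (kinetic s.1 + field_energy s.2).
Proof. by []. Qed.

(** The product of half the sum and the difference of the two fields is half the difference of their
    squares, and the Ampere equation expresses the sum of the currents through that difference.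
    Integrability of the left side is thus inherited from the continuous fields. *)
Lemma ampere_energy tau s0 s1 : tau != 0 ->
  admissible a b Wv s0 -> admissible a b Wv s1 -> ampere Wv tau s0 s1 ->
  has_integral mud (row @^-1` box a b)
    (fun t => dotv (avg_E s0.2 s1.2 (row t))
       (current Wv s0.1 (row t) + current Wv s1.1 (row t)))
    (- tau^-1 * (field_energy s1.2 + -1 * field_energy s0.2)).
Proof.
move=> tau0 [_ _ _ _ [_ c0]] [_ _ _ _ [_ c1]] amp.
have IE E : continuous E -> has_integral mud (row @^-1` box a b)
    (fun t => dotv (E (row t)) (E (row t))) (field_energy E).
  move=> cE; have iE : integrable_over (box a b) (fun x => dotv (E x) (E x)).
    by apply: integrable_over_box_continuous; exact: continuous_dotv_self.
  by split; first exact: iE.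
have IF := has_integralZ mD (- tau^-1)
  (has_integralD mD (IE _ c1) (has_integralZ mD (-1) (IE _ c0))).
apply: eq_has_integral IF => //.
move=> t _; move: (row t) (amp (row t)) => x.
move: (current Wv s0.1 x) (current Wv s1.1 x) => J0 J1 ampx.
rewrite /dotv !(mulr_sumr, mulr_suml) -big_split/= mulr_sumr.
apply: eq_bigr => i _.
have := congr1 (fun v : 'rV[R]_d => v 0 i) ampx; rewrite !mxE => ampi.
have -> : J0 0 i + J1 0 i = - 2 * (tau^-1 * (s1.2 x 0 i - s0.2 x 0 i)).
  by rewrite ampi; field.
field.
exact: tau0.
Qed.

(** Multiplied by [tau], the integral of [ampere_energy] is minus the gain in field energy, while
    [kinetic_step] equates it with the gain in kinetic energy. *)
Lemma kinetic_field_step tau s0 s1 kappa : tau != 0 ->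
  admissible a b Wv s0 -> admissible a b Wv s1 -> ampere Wv tau s0 s1 ->
  (forall x v, Wv v ->
     (s1.1 x v - s0.1 x v) / tau
     + kappa * dotv v (grad_x (avg_f s0.1 s1.1) x v)
     + dotv (avg_E s0.2 s1.2 x) (grad_v (avg_f s0.1 s1.1) x v) = 0) ->
  total_energy a b Wv s0 = total_energy a b Wv s1.
Proof.
move=> tau0 a0 a1 amp vl; have [iX IX] := ampere_energy tau0 a0 a1 amp.
have := kinetic_step (admissible_fP a0) (admissible_fP a1) tau0 vl iX.
rewrite [int_over _ _]IX mulrA mulrN mulfV// !total_energyE; lra.
Qed.

(** * Conservation by the elementary schemes and their compositions *)

Lemma scheme_2_energy tau s0 s1 : tau != 0 ->
  admissible a b Wv s0 -> admissible a b Wv s1 -> scheme_2 Wv tau s0 s1 ->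
  total_energy a b Wv s0 = total_energy a b Wv s1.
Proof.
move=> tau0 a0 a1 [vl amp]; apply: (kinetic_field_step (kappa := 1) tau0) => //.
by move=> x v Wv_; rewrite mul1r; exact: vl.
Qed.

Lemma scheme_b_energy tau s0 s1 : tau != 0 ->
  admissible a b Wv s0 -> admissible a b Wv s1 -> scheme_b Wv tau s0 s1 ->
  total_energy a b Wv s0 = total_energy a b Wv s1.
Proof.
move=> tau0 a0 a1 [vl amp]; apply: (kinetic_field_step (kappa := 0) tau0) => //.
by move=> x v Wv_; rewrite mul0r addr0; exact: vl.
Qed.

Lemma scheme_a_energy tau s0 s1 : tau != 0 ->
  admissible a b Wv s0 -> admissible a b Wv s1 -> scheme_a Wv tau s0 s1 ->
  total_energy a b Wv s0 = total_energy a b Wv s1.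
Proof.
move=> tau0 a0 a1 [vl sE].
have dot0 v : dotv 0 v = 0 :> R.
  by rewrite /dotv big1// => i _; rewrite mxE mul0r.
have [i0 I0] : has_integral mud (row @^-1` box a b)
    (fun t => dotv 0 (current Wv s0.1 (row t) + current Wv s1.1 (row t))) 0.
  by apply: eq_has_integral (has_integral0 _ _) => // t _; rewrite dot0.
have vl0 x v : Wv v ->
    (s1.1 x v - s0.1 x v) / tau
    + 1 * dotv v (grad_x (avg_f s0.1 s1.1) x v)
    + dotv 0 (grad_v (avg_f s0.1 s1.1) x v) = 0.
  by move=> Wv_; rewrite dot0 addr0 mul1r; exact: vl.
have := @kinetic_step _ _ (fun=> 0) tau 1 (admissible_fP a0) (admissible_fP a1)
  tau0 vl0 i0.
rewrite [int_over _ _]I0 mulr0 !total_energyE (_ : s1.2 = s0.2);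
  last exact/funext.
lra.
Qed.

Lemma step_comp_energy (P Q : state -> state -> Prop) s0 s1 :
  (forall s s', admissible a b Wv s -> admissible a b Wv s' -> P s s' ->
     total_energy a b Wv s = total_energy a b Wv s') ->
  (forall s s', admissible a b Wv s -> admissible a b Wv s' -> Q s s' ->
     total_energy a b Wv s = total_energy a b Wv s') ->
  admissible a b Wv s0 -> admissible a b Wv s1 ->
  step_comp a b Wv P Q s0 s1 ->
  total_energy a b Wv s0 = total_energy a b Wv s1.
Proof.
move=> HP HQ a0 a1 [s [as_ Qs Ps]].
by rewrite (HQ _ _ a0 as_ Qs) (HP _ _ as_ a1 Ps).
Qed.

Lemma scheme_4_energy tau s0 s1 : tau != 0 ->
  admissible a b Wv s0 -> admissible a b Wv s1 ->
  scheme_4 a b Wv tau s0 s1 ->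
  total_energy a b Wv s0 = total_energy a b Wv s1.
Proof.
move=> tau0; have tau20 : tau / 2 != 0 by rewrite mulf_neq0.
apply: step_comp_energy => s s'; first exact: scheme_a_energy.
apply: step_comp_energy => t t'; first exact: scheme_b_energy.
exact: scheme_a_energy.
Qed.

Lemma fourth_order_energy (S : R -> state -> state -> Prop) (dt : R) s0 s1 :
  (forall tau s s', tau != 0 ->
     admissible a b Wv s -> admissible a b Wv s' -> S tau s s' ->
     total_energy a b Wv s = total_energy a b Wv s') ->
  0 < dt -> admissible a b Wv s0 -> admissible a b Wv s1 ->
  fourth_order a b Wv S dt s0 s1 ->
  total_energy a b Wv s0 = total_energy a b Wv s1.
Proof.
move=> HS dt0.
have b1 : 2 / 3 <= beta1 :> R.
  rewrite ler_pM2r ?invr_gt0// -addrA lerDl addr_ge0 ?powR_ge0//.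
have b10 : beta1 * dt != 0 by rewrite mulf_neq0// gt_eqF//; lra.
have b20 : beta2 * dt != 0.
  by rewrite mulf_neq0//; [rewrite lt_eqF// /beta2; lra|rewrite gt_eqF].
apply: step_comp_energy => s s'; first exact: HS.
by apply: step_comp_energy => t t'; exact: HS.
Qed.

End energy.

Theorem theorem3p3 (R : realType) (d : nat) (a b : 'rV[R]_d)
    (Wv : set 'rV[R]_d) (dt : R) (s0 s1 : @state R d) :
  (forall i, a 0 i < b 0 i) ->
  velocity_domain Wv ->
  0 < dt ->
  admissible a b Wv s0 ->
  admissible a b Wv s1 ->
  scheme_2F a b Wv dt s0 s1 \/ scheme_4F a b Wv dt s0 s1 ->
  total_energy a b Wv s0 = total_energy a b Wv s1.
Proof.
move=> ab vW dt0 a0 a1 [] h;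
  apply: (fourth_order_energy _ dt0 a0 a1 h) => tau s s'.
- exact: scheme_2_energy.
- exact: scheme_4_energy.
Qed.
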